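(* Let $\lambda$ be a Borel measure on $\mathbb{R}^d$, let $\emptyset\neq\Omega\subseteq\mathbb{R}^d$ be open with $\lambda(\Omega)<\infty$, let $K\in\mathcal{K}$ be $\lambda$-symmetric, and let the nonlocal Friedrichs inequality be satisfied in $V_0$. If $u\in V$ is such that $$\mathcal{B}(u,v)\le 0\quad\text{for all }v\in V_0\text{ with }v\ge 0,$$ then $\operatorname{ess\,sup}_{x\in\Omega}u(x)\le\operatorname{ess\,sup}_{x\in\Gamma}u(x)$.
   Context: A transition kernel is a map $K:\mathbb{R}^d\times\mathcal{B}(\mathbb{R}^d)\to[0,\infty]$ ($\mathcal{B}(\mathbb{R}^d)$ the Borel $\sigma$-algebra) such that $K(x,\cdot)$ is a $\sigma$-finite measure for every $x$ and $K(\cdot,A)$ is Borel measurable for every $A$. It is non-degenerated if $x\mapsto\int f(x,y)\,K(x,\mathrm{d}y)$ is Borel measurable for every non-negative Borel measurable $f:\mathbb{R}^d\times\mathbb{R}^d\to\mathbb{R}$; $\mathcal{K}$ is the set of non-degenerated transition kernels. For a Borel measure $\lambda$, $K\in\mathcal{K}$ is $\lambda$-symmetric if $\lambda\otimes K=K\otimes\lambda$, where $(\lambda\otimes K)(M)=\int\int\chi_M(x,y)\,K(x,\mathrm{d}y)\,\mathrm{d}\lambda(x)$ and $(K\otimes\lambda)(M)=\int\int\chi_M(x,y)\,K(y,\mathrm{d}x)\,\mathrm{d}\lambda(y)$. $\Gamma=\{y\in\mathbb{R}^d\setminus\Omega: K(y,\Omega)>0\}$. $\mathcal{V}$ is the space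 of Borel measurable $v:\mathbb{R}^d\to\mathbb{R}$ with $\|v\|_{\mathcal{V}}^2=\int_\Omega v^2\,\mathrm{d}\lambda+\int_\Omega\int_{\mathbb{R}^d}(v(x)-v(y))^2\,K(x,\mathrm{d}y)\,\mathrm{d}\lambda(x)<\infty$, and $\mathcal{V}_0=\{v\in\mathcal{V}: v=0\text{ on }\mathbb{R}^d\setminus\Omega\}$. $V$ and $V_0$ are the spaces of classes of elements of $\mathcal{V}$ and $\mathcal{V}_0$, respectively, modulo $\ker\|\cdot\|_{\mathcal{V}}=\{v\in\mathcal{V}: v=0\ \lambda\text{-a.e. on }\Omega\cup\Gamma\}$; elements are treated as functions defined $\lambda$-a.e. on $\Omega\cup\Gamma$. On $V$ set $$\mathcal{B}(u,v)=\tfrac12\int_\Omega\int_\Omega(u(x)-u(y))(v(x)-v(y))\,K(x,\mathrm{d}y)\,\mathrm{d}\lambda(x)+\int_\Omega\int_{\mathbb{R}^d\setminus\Omega}(u(x)-u(y))(v(x)-v(y))\,K(x,\mathrm{d}y)\,\mathrm{d}\lambda(x).$$ The nonlocal Friedrichs inequality holds in $V_0$ if there is $C>0$ with $\|v\|_{L^2(\Omega,\lambda)}^2\le C\,\mathcal{B}(v,v)$ for all $v\in V_0$. The essential supremum is with respect to $\lambda$: $\operatorname{ess\,sup}_{x\in A}u(x)=\inf\{c\in\mathbb{R}: u(x)\le c\text{ for }\lambda\text{-a.e. }x\in A\}\in[-\infty,\infty]$. *)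

(* Defs.v *)
From HB Require Import structures.
From mathcomp Require Import all_boot all_order all_algebra.
From mathcomp Require Import all_classical all_reals all_analysis.
From mathcomp Require Import measurable_realfun.

Set Implicit Arguments.
Unset Strict Implicit.
Unset Printing Implicit Defensive.

Import Order.TTheory GRing.Theory Num.Theory.
Import numFieldNormedType.Exports.

Local Open Scope classical_set_scope.
Local Open Scope ring_scope.

(* R^d with its Borel sigma-algebra; the topology of 'rV[R]_d is that of the
   sup norm, i.e. the Euclidean one. *)
Notation borelRd R d := (g_sigma_algebraType (@open 'rV[R]_d)).

(* The definitions make sense over any measurable space T.  For T = R^d the
   product sigma-algebra on T * T is the Borel sigma-algebra of R^d x R^d. *)
Section kernels.
Context {disp : measure_display} {T : measurableType disp} {R : realType}.
Local Open Scope ereal_scope.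

Definition nondegenerated_kernel (K : R.-sigmafker T ~> T) : Prop :=
  forall f : T * T -> R,
    measurable_fun [set: T * T] f -> (forall z, (0 <= f z)%R) ->
    measurable_fun [set: T] (fun x => \int[K x]_y (f (x, y))%:E).

Definition prod_left (lambda : {measure set T -> \bar R})
    (K : R.-sigmafker T ~> T) (M : set (T * T)) : \bar R :=
  \int[lambda]_x \int[K x]_y (\1_M (x, y))%:E.

Definition prod_right (K : R.-sigmafker T ~> T)
    (lambda : {measure set T -> \bar R}) (M : set (T * T)) : \bar R :=
  \int[lambda]_y \int[K y]_x (\1_M (x, y))%:E.

Definition symmetric_kernel (lambda : {measure set T -> \bar R})
    (K : R.-sigmafker T ~> T) : Prop :=
  forall M : set (T * T), measurable M ->
    prod_left lambda K M = prod_right K lambda M.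

Definition esssup_on (lambda : {measure set T -> \bar R}) (A : set T)
    (u : T -> R) : \bar R :=
  ereal_inf [set c%:E | c in
    [set c : R | {ae lambda, forall x, A x -> (u x <= c)%R}]].

End kernels.

Section spaces.
Context {disp : measure_display} {T : measurableType disp} {R : realType}.
Variables (lambda : {measure set T -> \bar R}) (K : R.-sigmafker T ~> T).
Variable Omega : set T.
Local Open Scope ereal_scope.

Definition nlboundary : set T := [set y | ~ Omega y /\ 0 < K y Omega].

Definition sqL2norm (v : T -> R) : \bar R :=
  \int[lambda]_(x in Omega) ((v x) ^+ 2)%:E.

Definition sqVnorm (v : T -> R) : \bar R :=
  sqL2norm v + \int[lambda]_(x in Omega) \int[K x]_y ((v x - v y) ^+ 2)%:E.

Definition calV : Type := {v : {mfun T >-> R} | sqVnorm v < +oo}.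
HB.instance Definition _ := Choice.on calV.

Definition calV_fun (v : calV) : T -> R := val v.
Coercion calV_fun : calV >-> Funclass.

Definition calV0 : set calV := [set v | forall x, ~ Omega x -> v x = 0%R].

(* Equality modulo the kernel of the seminorm; see sqVnorm_eq0 below. *)
Definition eqV (v w : calV) : bool :=
  `[< {ae lambda, forall x, (Omega `|` nlboundary) x -> v x = w x} >].

Lemma eqV_refl : reflexive eqV.
Proof. by move=> v; apply/asboolP; apply: aeW. Qed.

Lemma eqV_sym : symmetric eqV.
Proof.
by move=> v w; apply/asboolP/asboolP; apply: filterS => x vw /vw.
Qed.

Lemma eqV_trans : transitive eqV.
Proof.
move=> w v z /asboolP vw /asboolP wz; apply/asboolP.
by apply: filterS2 vw wz => x vw wz xD; rewrite vw// wz.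
Qed.

Canonical eqV_equiv := EquivRel eqV eqV_refl eqV_sym eqV_trans.

Definition Vspace : Type := {eq_quot eqV}%qT.
HB.instance Definition _ := Choice.on Vspace.
HB.instance Definition _ := EqQuotient.on Vspace.

(* A class is used as a function through a chosen representative, determined
   lambda-a.e. on Omega `|` nlboundary. *)
Definition Vspace_fun (v : Vspace) : T -> R := calV_fun (repr v).
Coercion Vspace_fun : Vspace >-> Funclass.

Definition V0space : set Vspace := [set \pi_(Vspace)%qT v | v in calV0].

Definition nonnegV (v : Vspace) : Prop :=
  {ae lambda, forall x, (Omega `|` nlboundary) x -> (0 <= v x)%R}.

(* Both double integrals converge absolutely for u and v of finite seminorm. *)
Definition bilform (u v : T -> R) : \bar R :=
  (2^-1)%R%:E * (\int[lambda]_(x in Omega) \int[K x]_(y in Omega)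
                 ((u x - u y) * (v x - v y))%:E)
  + \int[lambda]_(x in Omega) \int[K x]_(y in ~` Omega)
      ((u x - u y) * (v x - v y))%:E.

Definition friedrichs : Prop :=
  exists2 C : R, (0 < C)%R &
    forall v : Vspace, V0space v -> sqL2norm v <= C%:E * bilform v v.

End spaces.

Section seminorm_kernel.
Context {disp : measure_display} {T : measurableType disp} {R : realType}.
Variables (lambda : {measure set T -> \bar R}) (K : R.-sigmafker T ~> T).
Variable Omega : set T.
Hypotheses (mOmega : measurable Omega) (K_nondeg : nondegenerated_kernel K).
Hypothesis K_sym : symmetric_kernel lambda K.
Local Open Scope ereal_scope.

Lemma kernel_rect_sym (A B : set T) : measurable A -> measurable B ->
  \int[lambda]_(x in A) K x B = \int[lambda]_(x in B) K x A.
Proof.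
move=> mA mB.
have := K_sym (measurableX mA mB); rewrite /prod_left /prod_right.
under eq_integral => x _.
  rewrite (_ : \int[_]_y _ = ((fun x => K x B) \_ A) x); first over.
  rewrite patchE; case: ifPn => xA.
    rewrite (eq_integral (fun y => (\1_B y)%:E)) ?integral_indic ?setIT//.
    by move=> y _; rewrite !indicE in_setX xA.
  by rewrite integral0_eq// => y _; rewrite indicE in_setX (negbTE xA).
rewrite -integral_mkcond => ->.
under eq_integral => x _.
  rewrite (_ : \int[_]_y _ = ((fun x => K x A) \_ B) x); first over.
  rewrite patchE; case: ifPn => xA.
    rewrite (eq_integral (fun y => (\1_A y)%:E)) ?integral_indic ?setIT//.
    by move=> y _; rewrite !indicE in_setX xA andbT.
  by rewrite integral0_eq// => y _; rewrite indicE in_setX (negbTE xA) andbF.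
by rewrite -integral_mkcond.
Qed.

Let int0P (mu : {measure set T -> \bar R}) (D : set T) (f : T -> \bar R) :
  measurable D -> measurable_fun [set: T] f -> (forall x, 0 <= f x) ->
  \int[mu]_(x in D) f x = 0 <-> {ae mu, forall x, D x -> f x = 0}.
Proof.
move=> mD mf f0.
rewrite (eq_integral (fun x => `|f x|)); last by move=> x _; rewrite gee0_abs.
exact: (ae_eq_integral_abs mu mD (measurable_funTS mf)).
Qed.

Lemma kernel_null_sym (N : set T) : measurable N ->
  {ae lambda, forall x, Omega x -> K x N = 0} <->
  {ae lambda, forall x, N x -> K x Omega = 0}.
Proof.
move=> mN.
rewrite -int0P//; last exact: measurable_kernel.
by rewrite kernel_rect_sym// int0P//; exact: measurable_kernel.
Qed.

(* The two descriptions of the kernel of the seminorm coincide. *)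
Lemma sqVnorm_eq0 (v : {mfun T >-> R}) : sqVnorm lambda K Omega v = 0 <->
  {ae lambda, forall x, (Omega `|` nlboundary K Omega) x -> v x = 0%R}.
Proof.
pose N := v @^-1` [set~ 0%R].
have mv : measurable_fun [set: T] v by exact: measurable_funPT.
have mN : measurable N.
  by rewrite -[N]setTI; apply: mv => //; exact: measurableC.
have mv2 : measurable_fun [set: T] (fun x => ((v x) ^+ 2)%:E).
  by apply/measurable_EFinP; exact: measurable_funX.
have mg : measurable_fun [set: T] (fun x => \int[K x]_y ((v x - v y) ^+ 2)%:E).
  apply: (K_nondeg (f := fun z => ((v z.1 - v z.2) ^+ 2)%R)).
    apply: measurable_funX; apply: measurable_funB.
      exact: measurableT_comp.
    exact: measurableT_comp.
  by move=> z; exact: sqr_ge0.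
have gP x : v x = 0%R ->
    \int[K x]_y ((v x - v y) ^+ 2)%:E = 0 <-> K x N = 0.
  move=> vx0; rewrite int0P//; last 2 first.
  - by apply/measurable_EFinP; apply: measurable_funX; exact: measurable_funB.
  - by move=> y; rewrite lee_fin sqr_ge0.
  split=> [[M [mM M0 NM]]|KN0].
    apply: (subset_measure0 mN mM) M0 => y /= vy; apply: NM => /(_ I) /eqP.
    by rewrite vx0 sub0r sqrrN eqe sqrf_eq0 => /eqP.
  exists N; split => // y /= /not_implyP[_ vy] vy0; apply: vy.
  by rewrite vx0 vy0 subrr expr0n.
rewrite /sqVnorm /sqL2norm; split.
  move=> /eqP; rewrite padde_eq0//; last 2 first.
  - by apply: integral_ge0 => x _; rewrite lee_fin sqr_ge0.
  - by apply: integral_ge0 => x _; apply: integral_ge0 => y _;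
      rewrite lee_fin sqr_ge0.
  move=> /andP[/eqP/int0P h1 /eqP/int0P h2].
  have {}h1 : {ae lambda, forall x, Omega x -> v x = 0%R}.
    apply: filterS (h1 _ _ _) => //; last first.
      by move=> x; rewrite lee_fin sqr_ge0.
    by move=> x vx0 /vx0 /eqP; rewrite eqe sqrf_eq0 => /eqP.
  have {}h2 := h2 mOmega mg _.
  have /kernel_null_sym-/(_ mN) h3 :
      {ae lambda, forall x, Omega x -> K x N = 0}.
    apply: filterS2 h1 (h2 _) => [x vx0 gx0 Ox|x].
      by apply/gP; [exact: vx0|exact: gx0].
    by apply: integral_ge0 => y _; rewrite lee_fin sqr_ge0.
  apply: filterS2 h1 h3 => x vx0 KN [/vx0//|[_ KO]].
  by apply/eqP; apply/negPn/negP => /eqP/KN KO0; rewrite KO0 ltxx in KO.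
move=> h.
have hO : {ae lambda, forall x, Omega x -> v x = 0%R}.
  by apply: filterS h => x vx0 Ox; apply: vx0; left.
have hN : {ae lambda, forall x, Omega x -> K x N = 0}.
  apply/kernel_null_sym => //; apply: filterS h => x vx0 Nx.
  apply/eqP; apply/negPn/negP => KO; apply: Nx; apply: vx0.
  have [Ox|Ox] := pselect (Omega x); [by left|right; split => //].
  by rewrite lt0e KO measure_ge0.
rewrite (_ : \int[_]_(_ in _) _ = 0) ?add0e; apply/int0P => //.
- by move=> x; apply: integral_ge0 => y _; rewrite lee_fin sqr_ge0.
- by apply: filterS2 hO hN => x vx0 KN Ox; apply/gP; [exact: vx0|exact: KN].
- by move=> x; rewrite lee_fin sqr_ge0.
- by apply: filterS hO => x vx0 /vx0 ->; rewrite expr0n.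
Qed.

End seminorm_kernel.

(* Main.v *)
Require Import Defs.
From HB Require Import structures.
From mathcomp Require Import all_boot all_order all_algebra.
From mathcomp Require Import all_classical all_reals all_analysis.
From mathcomp Require Import measurable_realfun lra.
Set Implicit Arguments.
Unset Strict Implicit.
Unset Printing Implicit Defensive.
Import Order.TTheory GRing.Theory Num.Theory.
Import numFieldNormedType.Exports.
Local Open Scope classical_set_scope.
Local Open Scope ring_scope.

(** This is Stampacchia's truncation method.  If c is an essential upper bound
    of u on the boundary Gamma, the claim is that u <= c almost everywhere on
    Omega; taking the infimum over c then compares the essential suprema.

    The test function is v = (u - c)^+ on Omega and v = 0 outside Omega.  It
    has finite norm because t |-> (t - c)^+ is 1-Lipschitz and lambda(Omega) is
    finite, provided v may be identified with (u - c)^+ in the double integrals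
    ([cutoff_excess_sqVnorm]).  On Gamma this holds since (u - c)^+ vanishes
    there; the rest of the complement of Omega is invisible: by symmetry of the
    kernel, an exceptional set that meets Omega and Gamma in null sets has
    K x-measure zero for almost every x in Omega ([ae_kernel_ae]).  This same
    fact makes the choice of representatives of the classes harmless.

    The pointwise inequality
      ((s-c)^+ - (t-c)^+)^2 <= (s - t) ((s-c)^+ - (t-c)^+)
    integrates to B(v, v) <= B(u, v) ([bilform_truncation_le]), and B(u, v) <= 0
    by assumption on u.  The Friedrichs inequality then forces v = 0 almost
    everywhere on Omega, which says u <= c there ([subsolution_le_on_domain]). *)

(** * Double integrals against a symmetric kernel *)

Section double_integral.
Context {disp : measure_display} {T : measurableType disp} {R : realType}.
Variables (lambda : {measure set T -> \bar R}) (K : R.-sigmafker T ~> T).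
Variable Omega : set T.
Hypotheses (mOmega : measurable Omega) (K_nondeg : nondegenerated_kernel K).
Hypothesis K_sym : symmetric_kernel lambda K.
Local Open Scope ereal_scope.

(** Nondegeneracy speaks of finite nonnegative integrands on the whole space;
    an indicator factor brings in the domain D, and signed integrands are split
    into positive and negative parts. *)
Lemma measurable_kernel_integral (D : set T) (f : T * T -> R) :
  measurable D -> measurable_fun [set: T * T] f ->
  measurable_fun [set: T] (fun x => \int[K x]_(y in D) (f (x, y))%:E).
Proof.
move=> mD mf.
have ge0_case (g : T * T -> R) : measurable_fun [set: T * T] g ->
    (forall z, 0 <= g z)%R ->
    measurable_fun [set: T] (fun x => \int[K x]_(y in D) (g (x, y))%:E).
  move=> mg g0.
  pose gD z := (g z * \1_D z.2)%R.
  rewrite (_ : (fun x => _) = (fun x => \int[K x]_y (gD (x, y))%:E)); last first.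
    apply/funext => x; rewrite integral_mkcond; apply: eq_integral => y _.
    by rewrite patchE /gD indicE; case: ifPn => _; rewrite ?mulr1 ?mulr0.
  apply: K_nondeg => [|z]; last by rewrite mulr_ge0.
  apply: measurable_funM => //.
  by apply: measurableT_comp; [exact: measurable_indic|exact: measurable_snd].
rewrite (_ : (fun x => _) =
    (fun x => \int[K x]_(y in D) (Num.max (f (x, y)) 0)%:E -
              \int[K x]_(y in D) (Num.max (- f (x, y)) 0)%:E)); last first.
  apply/funext => x; rewrite integralE; congr (_ - _);
  by apply: eq_integral => y _; rewrite EFin_max ?funeposE ?funenegE.
apply: emeasurable_funB.
  apply: (ge0_case (fun z => Num.max (f z) 0)%R).
    exact: measurable_maxr.
  by move=> z; rewrite le_max lexx orbT.
apply: (ge0_case (fun z => Num.max (- f z) 0)%R).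
  by apply: measurable_maxr => //; exact: measurableT_comp.
by move=> z; rewrite le_max lexx orbT.
Qed.

(** Only f is nonnegative everywhere: the product of increments occurring in
    the bilinear form is bounded below by a square merely almost everywhere. *)
Lemma ae_le_double_integral (D : set T) (f g : T * T -> R) :
  measurable D -> measurable_fun [set: T * T] f ->
  measurable_fun [set: T * T] g -> (forall z, 0 <= f z)%R ->
  {ae lambda, forall x, Omega x -> {ae K x, forall y, (f (x, y) <= g (x, y))%R}} ->
  \int[lambda]_(x in Omega) \int[K x]_(y in D) (f (x, y))%:E <=
  \int[lambda]_(x in Omega) \int[K x]_(y in D) (g (x, y))%:E.
Proof.
move=> mD mf mg f0 fg.
(* Monotonicity of the integral needs a nonnegative upper function; the
   absolute value of g changes no integral since 0 <= f <= g almost everywhere. *)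
pose g' (z : T * T) : R := `|g z|%R.
have mg' : measurable_fun [set: T * T] g' by exact: measurableT_comp.
have mf2 x : measurable_fun D (fun y => (f (x, y))%:E).
  by apply: measurable_funTS; apply/measurable_EFinP; exact: measurable_fun_pair2.
have mg2 x : measurable_fun D (fun y => (g (x, y))%:E).
  by apply: measurable_funTS; apply/measurable_EFinP; exact: measurable_fun_pair2.
have mg2' x : measurable_fun D (fun y => (g' (x, y))%:E).
  by apply: measurable_funTS; apply/measurable_EFinP; exact: measurable_fun_pair2.
rewrite [leRHS](ae_eq_integral
  (fun x => \int[K x]_(y in D) (g' (x, y))%:E)) //; last 3 first.
- by apply: measurable_funTS; exact: measurable_kernel_integral.
- by apply: measurable_funTS; exact: measurable_kernel_integral.
- apply: filterS fg => x /[apply] fg.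
  apply: ae_eq_integral => //.
  apply: filterS fg => y fg _; rewrite /g' ger0_norm//.
  exact: (le_trans (f0 (x,y)) fg).
apply: ae_ge0_le_integral => //.
- by move=> x _; apply: integral_ge0 => y _; rewrite lee_fin ?f0 ?normr_ge0.
- by apply: measurable_funTS; exact: measurable_kernel_integral.
- by move=> x _; apply: integral_ge0 => y _; rewrite lee_fin ?f0 ?normr_ge0.
- by apply: measurable_funTS; exact: measurable_kernel_integral.
apply: filterS fg => x /[apply] fg.
apply: ae_ge0_le_integral => //.
- by move=> y _; rewrite lee_fin ?f0 ?normr_ge0.
- by move=> y _; rewrite lee_fin ?f0 ?normr_ge0.
apply: filterS fg => y fg _; rewrite lee_fin.
exact: le_trans (ler_norm _).
Qed.

(** If P fails at a point outside Omega and Gamma, then K sends that point to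
    Omega with mass zero.  So K x Omega = 0 for almost every x in the
    complement of P, and symmetry reverses this into K x (~` P) = 0 for almost
    every x in Omega. *)
Lemma ae_kernel_ae (P : set T) : measurable P ->
  {ae lambda, forall x, (Omega `|` nlboundary K Omega) x -> P x} ->
  {ae lambda, forall x, Omega x -> P x /\ {ae K x, forall y, P y}}.
Proof.
move=> mP Pae.
have : {ae lambda, forall x, Omega x -> K x (~` P) = 0}.
  apply/kernel_null_sym => //; first exact: measurableC.
  apply: filterS Pae => x Px nPx.
  apply/eqP; apply: contra_notT nPx => KO; apply: Px.
  have [Ox|Ox] := pselect (Omega x); [by left|right; split => //].
  by rewrite lt0e KO measure_ge0.
apply: filterS2 Pae => x Px KP Ox; split; first by apply: Px; left.
exists (~` P); split => //; [exact: measurableC|exact: KP].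
Qed.

End double_integral.

(** * Truncation at a level *)

Section truncation.
Context {disp : measure_display} {T : measurableType disp} {R : realType}.
Variables (lambda : {measure set T -> \bar R}) (K : R.-sigmafker T ~> T).
Variable Omega : set T.
Hypotheses (mOmega : measurable Omega) (K_nondeg : nondegenerated_kernel K).
Hypothesis K_sym : symmetric_kernel lambda K.
Hypothesis Omega_fin : (lambda Omega < +oo)%E.

Definition excess (c t : R) : R := Num.max (t - c) 0.

Lemma excess_ge0 c t : 0 <= excess c t.
Proof. by rewrite /excess le_max lexx orbT. Qed.

Lemma excess_eq0 c t : (excess c t == 0) = (t <= c).
Proof. by rewrite /excess; case: (ltP (t - c) 0) => h; lra. Qed.

Lemma excess_sqr_le c t : excess c t ^+ 2 <= 2 * t ^+ 2 + 2 * c ^+ 2.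
Proof.
have := sqr_ge0 (t + c); have := sqr_ge0 t; have := sqr_ge0 c.
by rewrite /excess; case: (ltP (t - c) 0) => _; nra.
Qed.

(** The positive part is nondecreasing and 1-Lipschitz, so its increments have
    the sign of those of the argument and are no larger. *)
Lemma excess_sqr_diff_le c s t :
  (excess c s - excess c t) ^+ 2 <= (s - t) * (excess c s - excess c t).
Proof.
by rewrite /excess; case: (ltP (s - c) 0) => hs; case: (ltP (t - c) 0) => ht; nra.
Qed.

Lemma excess_lipschitz c s t : (excess c s - excess c t) ^+ 2 <= (s - t) ^+ 2.
Proof.
have := sqr_ge0 (s - c); have := sqr_ge0 (t - c); have := sqr_ge0 (s - t).
by rewrite /excess; case: (ltP (s - c) 0) => hs; case: (ltP (t - c) 0) => ht; nra.
Qed.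

(** The truncation of u must be cut off, because membership in V0 asks for
    zero values at every point outside Omega, also where u > c. *)
Definition cutoff_excess (u : T -> R) (c : R) (x : T) : R :=
  excess c (u x) * \1_Omega x.

Lemma cutoff_excess_ge0 u c x : 0 <= cutoff_excess u c x.
Proof. by rewrite mulr_ge0// excess_ge0. Qed.

Lemma measurable_excess (u : T -> R) c : measurable_fun [set: T] u ->
  measurable_fun [set: T] (fun x => excess c (u x)).
Proof. by move=> mu; apply: measurable_maxr => //; exact: measurable_funB. Qed.

Lemma measurable_cutoff_excess (u : T -> R) c : measurable_fun [set: T] u ->
  measurable_fun [set: T] (cutoff_excess u c).
Proof.
by move=> mu; apply: measurable_funM => //; exact: measurable_excess.
Qed.

Lemma cutoff_excess_eq (u : T -> R) c x :
  (nlboundary K Omega x -> u x <= c) ->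
  (Omega `|` nlboundary K Omega) x -> cutoff_excess u c x = excess c (u x).
Proof.
rewrite /cutoff_excess indicE => uc [Ox|Gx]; first by rewrite mem_set ?mulr1.
rewrite memNset ?mulr0; last by case: Gx.
by apply/esym/eqP; rewrite excess_eq0 uc.
Qed.

Lemma measurable_eq_set (f g : T -> R) :
  measurable_fun [set: T] f -> measurable_fun [set: T] g ->
  measurable [set x | f x = g x].
Proof.
move=> mf mg; rewrite -[X in measurable X]setTI.
rewrite (_ : [set x | f x = g x] = (fun x => f x - g x) @^-1` [set 0]).
  by apply: measurable_funB.
by apply/seteqP; split => x /= /eqP h; apply/eqP; rewrite subr_eq0 in h *.
Qed.

(** The L2 part is controlled by that of u and by c ^+ 2 times the finite
    measure of Omega, the increments by those of u: at K x-almost every y the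
    cut-off is not felt. *)
Lemma cutoff_excess_sqVnorm (u : T -> R) c : measurable_fun [set: T] u ->
  {ae lambda, forall x, nlboundary K Omega x -> u x <= c} ->
  (sqVnorm lambda K Omega u < +oo ->
   sqVnorm lambda K Omega (cutoff_excess u c) < +oo)%E.
Proof.
move=> mu uc.
have mv := measurable_cutoff_excess c mu.
have mdiff (f g : T -> R) : measurable_fun setT f -> measurable_fun setT g ->
    measurable_fun [set: T * T] (fun z => f z.1 - g z.2).
  by move=> mf mg; apply: measurable_funB; exact: measurableT_comp.
have ge0_dbl (f : T -> R) : (0 <= \int[lambda]_(x in Omega)
    \int[K x]_y ((f x - f y) ^+ 2)%:E)%E.
  by apply: integral_ge0 => x _; apply: integral_ge0 => y _; rewrite lee_fin sqr_ge0.
have ge0_sqL2 (f : T -> R) : (0 <= sqL2norm lambda Omega f)%E.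
  by apply: integral_ge0 => x _; rewrite lee_fin sqr_ge0.
rewrite /sqVnorm => ufin.
have u2fin : (sqL2norm lambda Omega u < +oo)%E.
  by apply: le_lt_trans ufin; rewrite leeDl.
apply: lte_add_pinfty; last first.
  apply: le_lt_trans (_ : _ <= \int[lambda]_(x in Omega)
      \int[K x]_y ((u x - u y) ^+ 2)%:E)%E _; last first.
    by apply: le_lt_trans ufin; rewrite leeDr.
  apply: (ae_le_double_integral mOmega K_nondeg
    (f := fun z => (cutoff_excess u c z.1 - cutoff_excess u c z.2) ^+ 2)
    (g := fun z => (u z.1 - u z.2) ^+ 2)) => //.
  - by apply: measurable_funX; exact: mdiff.
  - by apply: measurable_funX; exact: mdiff.
  - by move=> z; exact: sqr_ge0.
  have h := ae_kernel_ae mOmega K_sym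
    (measurable_eq_set mv (measurable_excess c mu)).
  apply: filterS (h (filterS _ uc)) => [x /[apply] -[/= vx Kx]|x ucx].
    by apply: filterS Kx => y /= vy; rewrite vx vy; exact: excess_lipschitz.
  exact: cutoff_excess_eq.
have mu2 : measurable_fun Omega (fun x => (u x ^+ 2)%:E).
  by apply: measurable_funTS; apply/measurable_EFinP; exact: measurable_funX.
apply: le_lt_trans (_ : _ <= \int[lambda]_(x in Omega)
    (2%:E * (u x ^+ 2)%:E + (2 * c ^+ 2)%:E))%E _.
  apply: ge0_le_integral => //.
  - by move=> x _; rewrite lee_fin sqr_ge0.
  - apply: measurable_funTS; apply/measurable_EFinP; exact: measurable_funX.
  - by apply: emeasurable_funD => //; exact: measurable_funeM.
  move=> x Ox; rewrite /cutoff_excess indicE mem_set// mulr1.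
  by rewrite -EFinM -EFinD lee_fin excess_sqr_le.
rewrite ge0_integralD//; last 3 first.
- by move=> x _; rewrite mule_ge0// lee_fin sqr_ge0.
- exact: measurable_funeM.
- by move=> x _; rewrite lee_fin mulr_ge0// sqr_ge0.
rewrite ge0_integralZl//; last by move=> x _; rewrite lee_fin sqr_ge0.
rewrite integral_cst//; apply: lte_add_pinfty; apply: lte_mul_pinfty => //.
by rewrite lee_fin mulr_ge0// sqr_ge0.
Qed.

End truncation.

(** * The weak maximum principle *)

Section maximum_principle.
Context {disp : measure_display} {T : measurableType disp} {R : realType}.
Variables (lambda : {measure set T -> \bar R}) (K : R.-sigmafker T ~> T).
Variable Omega : set T.
Hypotheses (mOmega : measurable Omega) (K_nondeg : nondegenerated_kernel K).
Hypothesis K_sym : symmetric_kernel lambda K.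

(** Stated for any w agreeing with the truncation on Omega and Gamma, so that
    it applies to an arbitrary representative of the class of the test
    function. *)
Lemma bilform_truncation_le (u w : T -> R) c :
  measurable_fun [set: T] u -> measurable_fun [set: T] w ->
  {ae lambda, forall x, (Omega `|` nlboundary K Omega) x ->
    w x = excess c (u x)} ->
  (bilform lambda K Omega w w <= bilform lambda K Omega u w)%E.
Proof.
move=> mu mw wu.
have incr (f : T -> R) : measurable_fun setT f ->
    measurable_fun [set: T * T] (fun z => f z.1 - f z.2).
  by move=> mf; apply: measurable_funB; exact: measurableT_comp.
have dbl_le (D : set T) : measurable D ->
    (\int[lambda]_(x in Omega) \int[K x]_(y in D)
       ((w x - w y) * (w x - w y))%:E <=
     \int[lambda]_(x in Omega) \int[K x]_(y in D)
       ((u x - u y) * (w x - w y))%:E)%E.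
  move=> mD.
  apply: (ae_le_double_integral mOmega K_nondeg
    (f := fun z => (w z.1 - w z.2) * (w z.1 - w z.2))
    (g := fun z => (u z.1 - u z.2) * (w z.1 - w z.2))) => //.
  - by apply: measurable_funM; exact: incr.
  - by apply: measurable_funM; exact: incr.
  - by move=> z; rewrite -expr2 sqr_ge0.
  have := ae_kernel_ae mOmega K_sym
    (measurable_eq_set mw (measurable_excess c mu)) wu.
  apply: filterS => x /[apply] -[/= wx Kx].
  by apply: filterS Kx => y /= wy; rewrite wx wy -expr2 excess_sqr_diff_le.
apply: leeD; last by apply: dbl_le; exact: measurableC.
by rewrite lee_pmul2l ?lte_fin ?invr_gt0//; exact: dbl_le.
Qed.

Lemma sqL2norm_le0_ae0 (w : T -> R) : measurable_fun [set: T] w ->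
  (sqL2norm lambda Omega w <= 0)%E ->
  {ae lambda, forall x, Omega x -> w x = 0}.
Proof.
move=> mw w0.
have mw2 : measurable_fun Omega (fun x => (w x ^+ 2)%:E).
  by apply: measurable_funTS; apply/measurable_EFinP; exact: measurable_funX.
have w2_ae0 : {ae lambda, forall x, Omega x -> (w x ^+ 2)%:E = 0%E}.
  apply/(ae_eq_integral_abs lambda mOmega mw2).
  under eq_integral => x _ do rewrite gee0_abs ?lee_fin ?sqr_ge0//.
  apply/eqP; rewrite eq_le w0 integral_ge0// => x _.
  by rewrite lee_fin sqr_ge0.
apply: filterS w2_ae0 => x /[apply] /eqP.
by rewrite eqe sqrf_eq0 => /eqP.
Qed.

Lemma Vspace_class_measurable (u : Vspace lambda K Omega) :
  measurable_fun [set: T] u.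
Proof. exact: measurable_funPT. Qed.

(** The class of the truncation is an admissible test function; its energy is
    at most B(u, w) <= 0, so the Friedrichs inequality kills it. *)
Lemma subsolution_le_on_domain (u : Vspace lambda K Omega) (c : R) :
  (lambda Omega < +oo)%E -> friedrichs lambda K Omega ->
  (forall v : Vspace lambda K Omega, V0space v -> nonnegV v ->
    (bilform lambda K Omega u v <= 0)%E) ->
  {ae lambda, forall x, nlboundary K Omega x -> u x <= c} ->
  {ae lambda, forall x, Omega x -> u x <= c}.
Proof.
move=> Omega_fin [C C0 friedC] u_sub uc.
have mu := Vspace_class_measurable u.
pose v := cutoff_excess Omega u c.
have mv : measurable_fun setT v by exact: measurable_cutoff_excess.
pose vm : {mfun T >-> R} := mfun_Sub (mem_set mv).
have vfin : (sqVnorm lambda K Omega vm < +oo)%E.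
  apply: (cutoff_excess_sqVnorm mOmega K_nondeg K_sym Omega_fin mu uc).
  exact: (valP (repr u)).
pose v0 : calV lambda K Omega := exist _ vm vfin.
pose w : Vspace lambda K Omega := \pi_(Vspace lambda K Omega)%qT v0.
have mw := Vspace_class_measurable w.
have wv : {ae lambda, forall x, (Omega `|` nlboundary K Omega) x -> w x = v x}.
  have /eqmodP/asboolP : repr w = v0 %[mod Vspace lambda K Omega]%qT.
    by rewrite reprK.
  by [].
have wu : {ae lambda, forall x, (Omega `|` nlboundary K Omega) x ->
    w x = excess c (u x)}.
  apply: filterS2 wv uc => x wvx ucx Dx; rewrite wvx//.
  exact: cutoff_excess_eq Dx.
have w0 : V0space w.
  exists v0 => // x nOx /=.
  by rewrite /calV_fun /= /v /cutoff_excess indicE memNset ?mulr0.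
have w_ge0 : nonnegV w.
  by apply: filterS wv => x wvx Dx; rewrite wvx// cutoff_excess_ge0.
have : (sqL2norm lambda Omega w <= 0)%E.
  apply: le_trans (friedC w w0) _.
  rewrite pmule_rle0 ?lte_fin//.
  exact: le_trans (bilform_truncation_le mu mw wu) (u_sub w w0 w_ge0).
move=> /(sqL2norm_le0_ae0 mw); apply: filterS2 wu => x wx wx0 Ox.
by rewrite -excess_eq0 -wx ?wx0//; left.
Qed.

End maximum_principle.

Theorem theorem7p2 (R : realType) (d : nat)
    (lambda : {measure set (borelRd R d) -> \bar R})
    (Omega : set 'rV[R]_d) (K : R.-sigmafker (borelRd R d) ~> (borelRd R d))
    (Omega_neq0 : Omega !=set0) (Omega_open : open Omega)
    (Omega_fin : (lambda Omega < +oo)%E)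
    (K_nondeg : nondegenerated_kernel K) (K_sym : symmetric_kernel lambda K)
    (K_friedrichs : friedrichs lambda K Omega)
    (u : Vspace lambda K Omega)
    (u_sub : forall v : Vspace lambda K Omega, V0space v -> nonnegV v ->
      (bilform lambda K Omega u v <= 0)%E) :
  (esssup_on lambda Omega u <= esssup_on lambda (nlboundary K Omega) u)%E.
Proof.
have mOmega : measurable (Omega : set (borelRd R d)).
  exact: sub_sigma_algebra.
(* Every essential upper bound on Gamma is one on Omega. *)
apply: ereal_inf_le_tmp => _ [c /= uc <-]; exists c => //=.
exact: subsolution_le_on_domain.
Qed.
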